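(* Let $\mathbb{F}\in\{\mathbb{R},\mathbb{C}\}$. For every $\epsilon>0$ there is an integer $k_0$ such that for every fixed integer $k\geq k_0$, \[\theta_\mathbb{F}(d,k)\leq (1+o(1))\frac{(1+\epsilon)\sqrt{k}}{d},\] where $o(1)\to 0$ as $d\to\infty$.
   Context: For positive integers $d,k$, $\theta_\mathbb{F}(d,k):=\min \max_{i\neq j}|\langle x_i,x_j\rangle|$, the minimum taken over all choices of $d+k$ unit vectors $x_1,\dots,x_{d+k}\in\mathbb{F}^d$. *)

(* Defs.v *)
From mathcomp Require Import all_boot all_order all_algebra.
From mathcomp Require Import complex.
From mathcomp Require Import all_classical all_reals all_analysis.
Import Order.TTheory GRing.Theory Num.Theory numFieldNormedType.Exports.

Set Implicit Arguments.
Unset Strict Implicit.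
Unset Printing Implicit Defensive.

Local Open Scope classical_set_scope.
Local Open Scope ring_scope.

Inductive base_field := Reals | Complexes.

Definition scalar (R : realType) (F : base_field) : fieldType :=
  match F with Reals => R | Complexes => R[i]%C end.

Definition scalar_conj (R : realType) (F : base_field) :
    scalar R F -> scalar R F :=
  match F with Reals => id | Complexes => conjc end.

Definition modulus (R : realType) (F : base_field) : scalar R F -> R :=
  match F return scalar R F -> R with
  | Reals => (Num.norm : R -> R)
  | Complexes => @ComplexField.Normc.normc R
  end.

Section Coherence.
Context (R : realType) (F : base_field).

Definition inner d (x y : 'rV[scalar R F]_d) : scalar R F :=
  \sum_(l < d) x ord0 l * scalar_conj (y ord0 l).

Definition l2norm d (x : 'rV[scalar R F]_d) : R :=
  Num.sqrt (\sum_(l < d) modulus (x ord0 l) ^+ 2).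

Definition unit_vectors d n : set ('I_n -> 'rV[scalar R F]_d) :=
  [set x | forall i, l2norm (x i) = 1].

(* The moduli are nonnegative (see [modulus_ge0]), so the default value [0] does
   not affect the maximum as soon as there is a pair of distinct indices. *)
Definition coherence d n (x : 'I_n -> 'rV[scalar R F]_d) : R :=
  \big[Num.max/0]_(p : 'I_n * 'I_n | p.1 != p.2)
    modulus (inner (x p.1) (x p.2)).

(* The infimum is attained as soon as [0 < d]: see [theta_min]. *)
Definition theta (d k : nat) : R :=
  inf [set coherence x | x in @unit_vectors d (d + k)].

Let re : scalar R F -> R :=
  match F return scalar R F -> R with
  | Reals => (id : R -> R) | Complexes => @complex.Re R end.

Let im : scalar R F -> R :=
  match F return scalar R F -> R with
  | Reals => (fun _ : R => 0 : R) | Complexes => @complex.Im R end.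

Let mk (a b : R) : scalar R F :=
  match F return scalar R F with
  | Reals => (a : R) | Complexes => Complex a b end.

Let c : R := match F with Reals => 0 | Complexes => 1 end.

Let mkK z : mk (re z) (im z) = z.
Proof. by rewrite /mk /re /im; move: z; case: F => // -[]. Qed.

Let re_mk a b : re (mk a b) = a.
Proof. by rewrite /mk /re; case: F. Qed.

Let im_mk a b : im (mk a b) = c * b.
Proof. by rewrite /mk /im /c; case: F; rewrite ?mul0r ?mul1r. Qed.

Let modulusE z : modulus z = Num.sqrt (re z ^+ 2 + im z ^+ 2).
Proof.
rewrite /modulus /re /im; move: z; case: F => [z|[]//].
by rewrite expr0n addr0 sqrtr_sqr.
Qed.

Lemma modulus_ge0 (z : scalar R F) : 0 <= modulus z.
Proof. by rewrite modulusE sqrtr_ge0. Qed.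

Let sqr_modulus z : modulus z ^+ 2 = re z ^+ 2 + im z ^+ 2.
Proof. by rewrite modulusE sqr_sqrtr// addr_ge0// sqr_ge0. Qed.

Let re_sum (I : Type) (r : seq I) (G : I -> scalar R F) :
  re (\sum_(i <- r) G i) = \sum_(i <- r) re (G i).
Proof.
by apply: (big_morph re); rewrite /re; case: F => //= -[? ?] [].
Qed.

Let im_sum (I : Type) (r : seq I) (G : I -> scalar R F) :
  im (\sum_(i <- r) G i) = \sum_(i <- r) im (G i).
Proof.
apply: (big_morph im); rewrite /im; case: F => //= [_ _|[? ?] []//].
by rewrite addr0.
Qed.

Let re_mul z w : re (z * scalar_conj w) = re z * re w + im z * im w.
Proof.
rewrite /re /im /scalar_conj; move: z w.
case: F => /= [z w|[a b] [a' b']] /=; first by rewrite mul0r addr0.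
by rewrite mulrN opprK.
Qed.

Let im_mul z w : im (z * scalar_conj w) = im z * re w - re z * im w.
Proof.
rewrite /re /im /scalar_conj; move: z w.
case: F => /= [z w|[a b] [a' b']] /=; first by rewrite mul0r mulr0 subr0.
by rewrite mulrN addrC.
Qed.

Lemma coherence_ge0 d n (x : 'I_n -> 'rV[scalar R F]_d) : 0 <= coherence x.
Proof. by apply: bigmax_ge_id. Qed.

Lemma unit_vectors_nonempty d n : (0 < d)%N -> (@unit_vectors d n) !=set0.
Proof.
case: d => // d _; exists (fun=> \row_l mk (l == ord0)%:R 0) => i /=.
rewrite /l2norm (bigD1 ord0)//= big1 ?addr0.
  by rewrite mxE sqr_modulus re_mk im_mk mulr0 expr0n addr0 expr1n sqrtr1.
move=> l /negbTE l0.
by rewrite mxE l0 sqr_modulus re_mk im_mk mulr0 expr0n addr0.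
Qed.

Import ArrowAsProduct.

Let T d n : topologicalType := ('I_n * 'I_d * bool)%type -> R.

Let config d n (f : T d n) : 'I_n -> 'rV[scalar R F]_d :=
  fun i => \row_l mk (f (i, l, true)) (f (i, l, false)).

Let add_cont (U : topologicalType) (f g : U -> R) :
  continuous f -> continuous g -> continuous (fun x => f x + g x).
Proof. by move=> fc gc x; apply: cvgD; [exact: fc|exact: gc]. Qed.

Let mul_cont (U : topologicalType) (f g : U -> R) :
  continuous f -> continuous g -> continuous (fun x => f x * g x).
Proof. by move=> fc gc x; apply: cvgM; [exact: fc|exact: gc]. Qed.

Let sum_cont (U : topologicalType) (I : Type) (r : seq I) (f : I -> U -> R) :
  (forall i, continuous (f i)) -> continuous (fun x => \sum_(i <- r) f i x).
Proof. by move=> fc; apply: continuous_big => //; exact: add_continuous. Qed.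

Let sqrt_cont (U : topologicalType) (f : U -> R) :
  continuous f -> continuous (fun x => Num.sqrt (f x)).
Proof.
by move=> fc x; apply: continuous_comp; [exact: fc|exact: sqrt_continuous].
Qed.

Let cst_cont (U : topologicalType) (a : R) : continuous (fun _ : U => a).
Proof. by move=> x; exact: cvg_cst. Qed.

Let coord_cont d n i : continuous (fun f : T d n => f i).
Proof. exact: (@proj_continuous _ (fun=> R) i). Qed.

Lemma theta_min (d k : nat) : (0 < d)%N ->
  exists2 x, @unit_vectors d (d + k) x &
    theta d k = coherence x /\
    forall y, @unit_vectors d (d + k) y -> coherence x <= coherence y.
Proof.
move=> d0; set n := (d + k)%N.
pose g i (f : T d n) : R := l2norm (config f i).
have gc i : continuous (g i).
  rewrite [g i](_ : _ = fun f => Num.sqrt (\sum_(l < d)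
      (f (i, l, true) * f (i, l, true) +
       (c * f (i, l, false)) * (c * f (i, l, false))))); last first.
    apply/funext => f; rewrite /g /l2norm; congr Num.sqrt.
    by apply: eq_bigr => l _; rewrite mxE sqr_modulus re_mk im_mk !expr2.
  apply/sqrt_cont/sum_cont => l; apply: add_cont; apply: mul_cont => //;
    by apply: mul_cont => //; exact: cst_cont.
have cc : continuous (fun f : T d n => coherence (config f)).
  apply: continuous_big; first exact: max_continuous.
  move=> [i j] /= _.
  rewrite [X in continuous X](_ : _ = fun f : T d n => Num.sqrt (
      (\sum_(l < d) (f (i, l, true) * f (j, l, true) +
        (c * f (i, l, false)) * (c * f (j, l, false)))) *
      (\sum_(l < d) (f (i, l, true) * f (j, l, true) +
        (c * f (i, l, false)) * (c * f (j, l, false)))) +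
      (\sum_(l < d) ((c * f (i, l, false)) * f (j, l, true) +
        (-1) * (f (i, l, true) * (c * f (j, l, false))))) *
      (\sum_(l < d) ((c * f (i, l, false)) * f (j, l, true) +
        (-1) * (f (i, l, true) * (c * f (j, l, false))))))); last first.
    apply/funext => f; rewrite modulusE /inner re_sum im_sum !expr2.
    congr (Num.sqrt (_ * _ + _ * _)); apply: eq_bigr => l _;
      by rewrite ?re_mul ?im_mul !mxE !re_mk !im_mk ?mulN1r.
  apply: sqrt_cont; apply: add_cont; apply: mul_cont; apply: sum_cont => l;
    repeat first [exact: coord_cont | exact: cst_cont
                 | apply: add_cont | apply: mul_cont].
pose K := [set f : T d n | forall i, `[(-1 : R), 1]%classic (f i)] `&`
          \bigcap_(i in [set: 'I_n]) (g i @^-1` [set 1]).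
have cbox : compact [set f : T d n | forall i, `[(-1 : R), 1]%classic (f i)].
  apply: (@tychonoff _ (fun=> R) (fun=> `[(-1 : R), 1]%classic)) => i.
  exact: segment_compact.
have cK : compact K.
  apply: (subclosed_compact _ cbox); last by move=> f [].
  apply: closedI.
    apply: compact_closed cbox; apply: (@hausdorff_product _ (fun=> R)) => i.
    exact: Rhausdorff.
  apply: closed_bigI => i _; apply: preimage_closed; last exact: closed_eq.
  by move=> x _; exact: gc.
have lift y : @unit_vectors d n y -> exists2 f, K f & config f = y.
  move=> yu.
  pose f : T d n := fun p =>
    if p.2 then re (y p.1.1 ord0 p.1.2) else im (y p.1.1 ord0 p.1.2).
  have fy : config f = y.
    by apply/funext => i; apply/rowP => l; rewrite mxE mkK.
  exists f => //; split; last by move=> i _; rewrite /= /g fy yu.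
  move=> [[i l] b] /=; rewrite in_itv/= -ler_norml.
  have : f (i, l, b) ^+ 2 <= 1.
    have := yu i; rewrite /l2norm => /(congr1 (fun t => t ^+ 2)).
    rewrite expr1n sqr_sqrtr; last by apply: sumr_ge0 => *; exact: sqr_ge0.
    move=> <-; rewrite (bigD1 l)//=.
    apply: (@le_trans _ _ (modulus (y i ord0 l) ^+ 2)); last first.
      by rewrite lerDl; apply: sumr_ge0 => *; exact: sqr_ge0.
    by rewrite sqr_modulus /f; case: b => /=; rewrite ?lerDl ?lerDr sqr_ge0.
  by rewrite -real_normK ?num_real// expr_le1.
have K0 : K !=set0.
  by have [y /lift[f Kf _]] := unit_vectors_nonempty n d0; exists f.
have /(compact_EVT_min K0 cK)[f Kf fmin] :
    {within K, continuous (fun f : T d n => coherence (config f))}.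
  exact: continuous_subspaceT.
have fu : @unit_vectors d n (config f).
  by move=> i; have [_ /(_ i I)] := set_mem Kf.
have min y : @unit_vectors d n y -> coherence (config f) <= coherence y.
  by move=> /lift[h Kh <-]; apply: fmin; exact: mem_set.
exists (config f) => //; split => //.
apply/eqP; rewrite eq_le; apply/andP; split.
  apply: ge_inf; last by exists (config f).
  by exists 0 => _ [y _ <-]; exact: coherence_ge0.
apply: lb_le_inf; first by exists (coherence (config f)), (config f).
by move=> _ [y yu <-]; exact: min.
Qed.

End Coherence.

(* Main.v *)
(* Take a K-net of order r: B is its set of r^2 points and phi i b the line of
   the i-th parallel class through b.  Let J carry #|B| orthogonal sign
   functions e_b (J is [m] x {+-1}^B).  For each class i, the vectors
     w_(i,b) = (1_{i = j} 1_{phi i b = c} e_b(l))_(j,c,l),  b in B,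
   are orthogonal of squared norm a = #|J|; they are the rows of a matrix W_i.
   The matrix G = 1 - (a (K-1))^-1 sum_(i != j) W_i^T W_j is positive
   semidefinite and is killed by the r^2 rows of sum_i W_i, so n = K r #|J|
   vectors with Gram matrix G fit in dimension n - r^2.  Lines of distinct
   classes meet at most once, hence the off-diagonal entries of G are at most
   (a (K-1))^-1 = (K / (K-1)) r / n.  For r = 1 mod K!, the affine maps
   b |-> b.1 i + b.2 over Z/r form such a net; these r have bounded gaps, so
   one of them is at least sqrt k and asymptotic to sqrt k.  All the vectors are
   real, which also settles the complex case. *)
Require Import Defs.
From mathcomp Require Import all_boot all_order all_algebra.
From mathcomp Require Import complex ring lra zify.
From mathcomp Require Import all_classical all_reals all_analysis.
Import numFieldNormedType.Exports.
Import Order.TTheory GRing.Theory Num.Theory.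

Local Open Scope classical_set_scope.
Local Open Scope ring_scope.

(** * Positive semidefinite matrices as Gram matrices *)

(** Induction on [r]: eliminating with a nonzero diagonal pivot splits off one column of [V] and
    lowers the rank. If the diagonal vanishes, testing the form on [e i + e j] and [e i - e j]
    forces [G = 0]. *)
Lemma psd_factor (R : rcfType) (n r : nat) (G : 'M[R]_n) :
  G^T = G -> (forall u : 'rV[R]_n, 0 <= (u *m G *m u^T) 0 0) ->
  (\rank G <= r)%N -> exists V : 'M[R]_(n, r), V *m V^T = G.
Proof.
elim: r G => [|r IHr] G symG psdG rankG.
  exists 0; rewrite mul0mx; apply/esym/eqP.
  by rewrite -mxrank_eq0 -leqn0.
pose e (i : 'I_n) : 'rV[R]_n := delta_mx 0 i.
have Gij i j : G i j = (e i *m G *m (e j)^T) 0 0.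
  by rewrite /e -matrix.rowE trmx_delta -matrix.colE !mxE.
have [[i Gii]|diag0] := pselect (exists i, G i i != 0); last first.
  have {}diag0 i : G i i = 0.
    by apply/eqP/negP => /negP Gii; apply: diag0; exists i.
  exists 0; rewrite mul0mx; apply/matrixP => i j; rewrite mxE.
  have form s : 0 <= s * G i j *+ 2.
    have := psdG (e i + s *: e j).
    rewrite linearD /= linearZ /= !mulmxDl !mulmxDr -!scalemxAl -!scalemxAr.
    have addE (A B : 'M[R]_1) : (A + B) 0 0 = A 0 0 + B 0 0 by rewrite mxE.
    have scaleE c (A : 'M[R]_1) : (c *: A) 0 0 = c * A 0 0 by rewrite mxE.
    rewrite !addE !scaleE -!Gij !diag0 -(congr1 (fun M : 'M[R]_n => M i j) symG) mxE.
    by rewrite !mulr0 add0r addr0 mulr2n.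
  have := form 1; have := form (-1).
  by rewrite mul1r mulN1r mulNrn oppr_ge0 => h1 h2; lra.
have gii : 0 < G i i by rewrite lt_neqAle eq_sym Gii Gij psdG.
have := Gij i i; move: (e i) => {Gij}e Gii_e.
(* One step of Gaussian elimination with pivot [G i i]; [H] has smaller rank. *)
have [H HE] : exists H, H = G - (G i i)^-1 *: (G *m e^T *m (e *m G)).
  by eexists.
have He : H *m e^T = 0.
  rewrite HE mulmxBl -scalemxAl -[X in _ *: X]mulmxA.
  have -> : e *m G *m e^T = (G i i)%:M.
    by rewrite [LHS]mx11_scalar -Gii_e.
  by rewrite mul_mx_scalar scalerA mulVf// scale1r subrr.
have symH : H^T = H.
  by rewrite HE linearB /= linearZ /= !trmx_mul !trmxK symG.
have psdH (u : 'rV[R]_n) : 0 <= (u *m H *m u^T) 0 0.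
  (* Since [H] kills [e], [u] may be replaced by its part that is [G]-orthogonal to [e], on which
     the forms of [H] and [G] agree. *)
  have -> : u *m H *m u^T = (u - (u *m G *m e^T *m ((G i i)^-1)%:M) *m e) *m H
    *m (u - (u *m G *m e^T *m ((G i i)^-1)%:M) *m e)^T.
    have eH : e *m H = 0 by rewrite -symH -[e]trmxK -trmx_mul He trmx0.
    rewrite [(u - _)^T]linearB /= trmx_mul mulmxBl -(mulmxA _ e) eH mulmx0 subr0.
    by rewrite mulmxBr -!(mulmxA u) (mulmxA H) He mul0mx mulmx0 subr0.
  set v := u - _.
  have ve : v *m G *m e^T = 0.
    rewrite mulmxBl mulmxBl -!mulmxA.
    have -> : e *m (G *m e^T) = (G i i)%:M.
      by rewrite mulmxA [LHS]mx11_scalar -Gii_e.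
    by rewrite -scalar_mxM mulVf// mulmx1 subrr.
  rewrite HE mulmxBr -scalemxAr !mulmxA ve !mul0mx scaler0 subr0.
  exact: psdG.
have rankH : (\rank H <= r)%N.
  (* The row space of [H] lies in that of [G], strictly: [H] kills [e], while [e *m G *m e^T] is the
     nonzero pivot. *)
  rewrite -ltnS; apply: leq_trans rankG; apply: rank_ltmx.
  rewrite ltmxE; apply/andP; split.
    rewrite HE mulmxA scalemxAl -{1}(mul1mx G) -mulmxBl.
    exact: submxMl.
  apply/negP => /submxP[D GD].
  have : (e *m G *m e^T) 0 0 = 0.
    by rewrite GD -!mulmxA He !mulmx0 mxE.
  by rewrite -Gii_e; apply/eqP.
have [V VH] := IHr H symH psdH rankH.
pose U : 'M[R]_(n, 1 + r) := row_mx ((Num.sqrt (G i i))^-1 *: (G *m e^T)) V.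
suff : U *m U^T = G by exists U.
rewrite tr_row_mx mul_row_col VH [(_ *: _)^T]linearZ /= -scalemxAl -scalemxAr scalerA.
rewrite -invfM -expr2 sqr_sqrtr ?ltW// trmx_mul trmxK symG.
by rewrite HE addrC subrK.
Qed.

(** The matrix is a nonnegative combination of two orthogonal projections and is annihilated by the
    [t] independent rows of the sum of the [W i], so its rank is at most [n - t <= d]. *)
Lemma net_gram (R : rcfType) (K t n d : nat) (a : R) (W : 'I_K -> 'M[R]_(t, n)) :
  (1 < K)%N -> 0 < a ->
  (forall i j, W i *m (W j)^T = (a *+ (i == j))%:M) -> (n <= d + t)%N ->
  exists V : 'M[R]_(n, d), V *m V^T =
    1%:M - (a * K.-1%:R)^-1 *: \sum_i \sum_(j | j != i) (W i)^T *m W j.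
Proof.
move=> K1 a0 WW nd.
have K0 : 0 < K%:R :> R by rewrite ltr0n ltnW.
have K10 : 0 < K.-1%:R :> R by rewrite ltr0n; case: K K1 {W WW K0} => [|[]].
have KE : K%:R = K.-1%:R + 1 :> R.
  by rewrite natr1 prednK// ltnW.
pose S := \sum_i W i; pose Y := \sum_i (W i)^T *m W i.
pose Q := a^-1 *: Y; pose P := (a * K%:R)^-1 *: (S^T *m S).
(* [Q] projects onto the span of all rows of all [W i], [P] onto that of the rows
   of [S], so that [1 - Q] and [Q - P] are orthogonal projections too. *)
have WQ i : W i *m Q = W i.
  rewrite -scalemxAr mulmx_sumr (bigD1 i)//= big1 ?addr0.
    by rewrite mulmxA WW eqxx mul_scalar_mx scalerA mulVf ?gt_eqF ?scale1r.
  by move=> j /negbTE ji; rewrite mulmxA WW eq_sym ji mul_scalar_mx scale0r.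
have SQ : S *m Q = S by rewrite mulmx_suml; apply: eq_bigr.
have QQ : Q *m Q = Q.
  rewrite {1}/Q -scalemxAl mulmx_suml; congr (_ *: _).
  by apply: eq_bigr => i _; rewrite -mulmxA WQ.
have SS : S *m S^T = (a * K%:R)%:M.
  rewrite [X in _ *m X]raddf_sum mulmx_suml.
  under eq_bigr => i _.
    rewrite mulmx_sumr (bigD1 i)//= big1 ?addr0; last first.
      by move=> j /negbTE ji; rewrite WW eq_sym ji mulr0n raddf0.
    rewrite WW eqxx; over.
  by rewrite sumr_const card_ord mulr_natr mulr1n [RHS]raddfMn.
have SP : S *m P = S.
  rewrite -scalemxAr mulmxA SS mul_scalar_mx scalerA mulVf ?scale1r//.
  by rewrite gt_eqF// mulr_gt0.
have PP : P *m P = P by rewrite {1}/P -scalemxAl -mulmxA SP.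
have PQ : P *m Q = P by rewrite /P -scalemxAl -mulmxA SQ.
have QT : Q^T = Q.
  rewrite /Q [LHS]linearZ /= [Y^T]raddf_sum; congr (_ *: _).
  by apply: eq_bigr => i _ /=; rewrite trmx_mul trmxK.
have PT : P^T = P by rewrite /P [LHS]linearZ /= trmx_mul trmxK.
have QP : Q *m P = P by rewrite -{1}QT -{1}PT -trmx_mul PQ.
set G := 1%:M - _.
(* The double sum is [S^T *m S - Y], that is [a K P - a Q]; the coefficient of [Q] in [G] is then
   [1 / (K - 1) = c - 1]. *)
pose c : R := K%:R / K.-1%:R.
have GE : G = (1%:M - Q) + c *: (Q - P).
  have -> : G = 1%:M - (a * K.-1%:R)^-1 *: ((a * K%:R) *: P - a *: Q).
    congr (_ - _ *: _); rewrite !scalerA !mulfV ?gt_eqF ?mulr_gt0// !scale1r.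
    rewrite [X in X *m _]raddf_sum mulmx_suml -sumrB; apply: eq_bigr => i _.
    by rewrite mulmx_sumr [in RHS](bigD1 i)//= addrC addrK.
  apply/matrixP => p q; rewrite !mxE /c KE.
  field.
  by rewrite !gt_eqF.
apply: psd_factor.
- rewrite GE; have trB (A B : 'M[R]_n) : (A - B)^T = A^T - B^T by exact: linearB.
  by rewrite [LHS]linearD /= [(_ *: _)^T]linearZ /= !trB trmx1 QT PT.
- move=> u.
  have trB (A B : 'M[R]_n) : (A - B)^T = A^T - B^T by exact: linearB.
  have EE : 1%:M - Q = (1%:M - Q) *m (1%:M - Q)^T.
    rewrite trB trmx1 QT mulmxBl mulmxBr !mul1mx mulmxBr mulmx1 QQ.
    by rewrite subrr subr0.
  have DD : Q - P = (Q - P) *m (Q - P)^T.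
    rewrite trB QT PT mulmxBl !mulmxBr QQ QP PQ PP.
    by rewrite subrr subr0.
  have sq p (v : 'rV[R]_p) : 0 <= (v *m v^T) 0 0.
    by rewrite mxE sumr_ge0// => j _; rewrite mxE -expr2 sqr_ge0.
  rewrite GE EE DD mulmxDr mulmxDl -scalemxAr -scalemxAl.
  rewrite !mulmxA -!(mulmxA (u *m _)) -!trmx_mul mxE [X in _ + X]mxE.
  by rewrite addr_ge0 ?mulr_ge0 ?sq// divr_ge0// ltW.
- have SG : S *m G = 0.
    by rewrite GE mulmxDr -scalemxAr !mulmxBr mulmx1 SQ SP !subrr scaler0 addr0.
  have : (\rank S + \rank G <= n)%N by apply: mulmx0_rank_max.
  have /eqP -> : row_free S.
    apply/row_freeP; exists ((a * K%:R)^-1 *: S^T).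
    rewrite -scalemxAr SS scale_scalar_mx mulVf//.
    by rewrite gt_eqF// mulr_gt0.
  by rewrite addnC => /leq_trans/(_ nd); rewrite leq_add2r.
Qed.

(** * From real Gram matrices to [theta] *)

Definition of_real {R : realType} (F : base_field) : R -> Defs.scalar R F :=
  match F with Reals => id | Complexes => fun a => Complex a 0 end.

Lemma modulus_of_real (R : realType) (F : base_field) (a : R) :
  modulus (of_real F a) = `|a|.
Proof. by case: F => //=; rewrite expr0n addr0 sqrtr_sqr. Qed.

Lemma inner_of_real (R : realType) (F : base_field) (d : nat) (x y : 'rV[R]_d) :
  inner (map_mx (of_real F) x) (map_mx (of_real F) y) =
  of_real F ((x *m y^T) ord0 ord0).
Proof.
rewrite /inner mxE; under eq_bigr do rewrite !mxE.
under [in RHS]eq_bigr do rewrite mxE.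
case: F => //; rewrite -[RHS]/(real_complex R _) raddf_sum.
apply: eq_bigr => l _ /=; apply/eqP.
by rewrite /conjc oppr0 eq_complex /= !mulr0 mul0r subr0 addr0 !eqxx.
Qed.

(** The first [d + k] rows of [V], read in the base field, compete in the infimum. The condition
    [0 <= b] handles the default value of the maximum. *)
Lemma theta_le_gram (R : realType) (F : base_field) (n d k : nat)
    (V : 'M[R]_(n, d)) (b : R) :
  (d + k <= n)%N -> 0 <= b -> (forall i, (V *m V^T) i i = 1) ->
  (forall i j, i != j -> `|(V *m V^T) i j| <= b) -> theta R F d k <= b.
Proof.
move=> dkn b0 V1 Vb.
pose x i := map_mx (of_real F) (row (widen_ord dkn i) V).
have VE i j : (row i V *m (row j V)^T) ord0 ord0 = (V *m V^T) i j.
  by rewrite !mxE; apply: eq_bigr => l _; rewrite !mxE.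
apply: (@le_trans _ _ (coherence x)).
  apply: ge_inf; first by exists 0 => _ [y _ <-]; exact: coherence_ge0.
  exists x => // i /=; rewrite /l2norm.
  rewrite -[RHS]sqrtr1 -(V1 (widen_ord dkn i)) -VE mxE.
  congr Num.sqrt; apply: eq_bigr => l _.
  by rewrite /x [in LHS]mxE modulus_of_real real_normK ?num_real// expr2 [in RHS](mxE _ _ l).
apply: bigmax_le => // -[i j] /= ij.
by rewrite inner_of_real modulus_of_real VE Vb.
Qed.

(** * Vectors built from a net and sign functions *)

Section Net.
Context (R : realType) (K m s : nat) (B C : finType) (phi : 'I_K -> B -> C).
Hypothesis phi_net :
  forall i j, i != j -> injective (fun b => (phi i b, phi j b)).

(** The summand ['I_s] is padding on which every [w i b] vanishes; it allows dimensions that are not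
    of the exact product form. *)
Let T : finType := ('I_K * C * ('I_m * {ffun B -> bool}) + 'I_s)%type.

Let w (i : 'I_K) (b : B) (x : T) : R :=
  match x with
  | inl (j, c, (_, f)) => ((i == j) && (phi i b == c))%:R * (-1) ^+ f b
  | inr _ => 0
  end.

Let flip (b : B) (f : {ffun B -> bool}) := [ffun b' => (b' == b) (+) f b'].

(** For distinct points, flipping the sign of [f] at [b] permutes the functions and negates each
    term, so the sum is its own opposite. *)
Let signs_orth (b b' : B) :
  \sum_(f : {ffun B -> bool}) (-1) ^+ f b * (-1) ^+ f b' =
  (2 ^ #|B|)%:R *+ (b == b') :> R.
Proof.
have [<-|bb'] := eqVneq b b'.
  under eq_bigr do rewrite -signr_addb addbb expr0.
  by rewrite sumr_const card_ffun card_bool.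
have flipK : involutive (flip b).
  by move=> f; apply/ffunP => x; rewrite !ffunE addbA addbb.
set S := LHS.
have : S = - S.
  rewrite {1}/S (reindex_inj (inv_inj flipK)) -sumrN; apply: eq_bigr => f _.
  by rewrite !ffunE eqxx eq_sym (negbTE bb') addTb addFb signrN mulNr.
by move: S => S SN; rewrite mulr0n; lra.
Qed.

Let big_T (G : T -> R) : (forall x, G (inr x) = 0) ->
  \sum_x G x = \sum_j \sum_c \sum_l \sum_f G (inl (j, c, (l, f))).
Proof.
move=> G0; rewrite big_sumType /= [X in _ + X]big1// addr0 pair_bigA /=.
under [RHS]eq_bigr do rewrite pair_bigA /=.
by rewrite pair_bigA /=; apply: eq_bigr => -[[j c] [l f]].
Qed.

Let w_orth i j b b' :
  \sum_x w i b x * w j b' x =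
  ((m * 2 ^ #|B|)%:R *+ (i == j)) *+ (b == b').
Proof.
rewrite big_T => [|x]; last by rewrite mulr0.
rewrite (bigD1 i)//= [X in _ + X]big1 ?addr0; last first.
  move=> l li; rewrite big1// => c _; rewrite big1// => ? _.
  by rewrite big1// => f _; rewrite /= eq_sym (negbTE li) !mul0r.
rewrite (bigD1 (phi i b))//= [X in _ + X]big1 ?addr0; last first.
  move=> c cb; rewrite big1// => ? _; rewrite big1// => f _ /=.
  by rewrite [phi i b == c]eq_sym (negbTE cb) andbF !mul0r.
rewrite !eqxx sumr_const card_ord /=.
have [ij|ij] := eqVneq i j; last first.
  by rewrite mul0rn big1 ?mul0rn// => f _; rewrite mul0r mulr0.
have [<-|bb'] := eqVneq b b'.
  rewrite natrM mulr_natl !mulr1n; congr (_ *+ _).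
  have := signs_orth b b; rewrite eqxx mulr1n => <-.
  by apply: eq_bigr => f _; rewrite ij !eqxx !mul1r.
rewrite mulr0n; under eq_bigr do rewrite mul1r mulrCA.
by rewrite -mulr_sumr signs_orth (negbTE bb') mulr0n mulr0 mul0rn.
Qed.

(** A coordinate belongs to at most one class. This makes the diagonal of the Gram matrix equal to
    1. *)
Let w_diag i j b x : i != j -> w i b x * w j b x = 0.
Proof.
case: x => [[[l c] [? f]]|? _] /=; last by rewrite mul0r.
have [<-|_ _] := eqVneq i l; last by rewrite !mul0r.
by rewrite eq_sym => /negbTE ->; rewrite mul0r mulr0.
Qed.

(** Only the pair of classes of [x] and [y] contributes, and there only points common to the two
    lines: at most one by [phi_net], with a term of modulus 1. *)
Let w_cross x y : `|\sum_i \sum_(j | j != i) \sum_b w i b x * w j b y| <= 1.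
Proof.
case: x => [[[i c] [? f]]|?]; last first.
  rewrite big1 ?normr0// => i _; rewrite big1// => j _; rewrite big1// => b _.
  by rewrite mul0r.
case: y => [[[j c'] [? g]]|?]; last first.
  rewrite big1 ?normr0// => l _; rewrite big1// => j _; rewrite big1// => b _.
  by rewrite mulr0.
rewrite (bigD1 i)//= [X in _ + X]big1 ?addr0; last first.
  move=> l li; rewrite big1// => j' _; rewrite big1// => b _.
  by rewrite (negbTE li) !mul0r.
have [ij|ij] := eqVneq j i.
  rewrite big1 ?normr0// => l li; rewrite big1// => b _.
  by rewrite ij (negbTE li) mul0r mulr0.
rewrite (bigD1 j)//= [X in _ + X]big1 ?addr0; last first.
  move=> l /andP[_ lj]; rewrite big1// => b _.
  by rewrite (negbTE lj) mul0r mulr0.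
rewrite !eqxx /=.
have [[b /andP[/eqP bc /eqP bc']]|noB] :=
    pselect (exists b, (phi i b == c) && (phi j b == c')).
  rewrite (bigD1 b)//= [X in _ + X]big1 ?addr0.
    by rewrite !normrM !normrX !normrN1 !expr1n !mulr1 bc bc' !eqxx normr1 mulr1.
  move=> b' bb'; case: eqP => [ec|_]; last by rewrite !mul0r.
  case: eqP => [ec'|_]; last by rewrite mul0r mulr0.
  have : b' = b by apply: (phi_net _ _ ij); rewrite /= ec ec' bc bc'.
  by move=> E; rewrite E eqxx in bb'.
rewrite big1 ?normr0// => b _.
case: eqP => [ec|_]; last by rewrite !mul0r.
case: eqP => [ec'|_]; last by rewrite mul0r mulr0.
by exfalso; apply: noB; exists b; rewrite ec ec' !eqxx.
Qed.

Lemma theta_le_net_pad (F : base_field) (d k : nat) :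
  (1 < K)%N -> (0 < m)%N -> (k <= #|B|)%N ->
  (d + #|B| = K * #|C| * (m * 2 ^ #|B|) + s)%N ->
  theta R F d k <= ((m * 2 ^ #|B| * K.-1)%:R)^-1.
Proof.
move=> K1 m0 kB dB.
set a : R := (m * 2 ^ #|B|)%:R.
have a0 : 0 < a by rewrite ltr0n muln_gt0 m0 expn_gt0.
have cardT : #|T| = (d + #|B|)%N.
  by rewrite dB card_sum !card_prod card_ffun card_bool !card_ord.
pose W i : 'M[R]_(#|B|, #|T|) :=
  \matrix_(b, x) w i (enum_val b) (enum_val x).
have WW i j : W i *m (W j)^T = (a *+ (i == j))%:M.
  apply/matrixP => b b'; rewrite !mxE.
  rewrite -(inj_eq enum_val_inj) -w_orth [RHS](reindex _ (onW_bij _ (enum_val_bij T))) /=.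
  by apply: eq_bigr => x _; rewrite !mxE.
have [V VV] := net_gram _ _ _ _ d _ _ K1 a0 WW (eq_leq cardT).
have crossE x y : (\sum_i \sum_(j | j != i) (W i)^T *m W j) x y =
    \sum_i \sum_(j | j != i) \sum_b w i b (enum_val x) * w j b (enum_val y).
  rewrite summxE; apply: eq_bigr => i _; rewrite summxE; apply: eq_bigr => j _.
  rewrite mxE [RHS](reindex _ (onW_bij _ (enum_val_bij B))) /=.
  by apply: eq_bigr => b _; rewrite !mxE.
have Vxy x y : (V *m V^T) x y = (x == y)%:R - (a * K.-1%:R)^-1 *
    \sum_i \sum_(j | j != i) \sum_b w i b (enum_val x) * w j b (enum_val y).
  by rewrite VV -crossE; rewrite mxE [X in _ + X]mxE [X in - X]mxE [X in X - _]mxE.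
rewrite natrM -/a.
have aK0 : 0 <= (a * K.-1%:R)^-1 by rewrite invr_ge0 mulr_ge0// ltW.
apply: (theta_le_gram _ _ _ _ _ V) => //.
  by rewrite cardT leq_add2l.
- move=> x; rewrite Vxy eqxx big1 ?mulr0 ?subr0// => i _.
  by rewrite big1// => j ji; rewrite big1// => b _; rewrite w_diag// eq_sym.
- move=> x y /negbTE xy; rewrite Vxy xy sub0r normrN normrM.
  by rewrite ger0_norm// ler_piMr// w_cross.
Qed.

End Net.

(** * The affine net over Z/r *)

(** Subtracting the two coordinates leaves [b.1] times [j - i], which is a unit modulo [r] because
    it divides [K!]. *)
Lemma Zp_net (K r : nat) (i j : 'I_K) : (1 < r)%N -> coprime r K`! -> i != j ->
  injective (fun b : 'Z_r * 'Z_r => (b.1 * i%:R + b.2, b.1 * j%:R + b.2)).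
Proof.
move=> r1 rK; wlog ij : i j / (i < j)%N => [wlg ij|_].
  have [ltij|ltji|/val_inj eqij] := ltngtP i j.
  - exact: wlg.
  - have inj := wlg _ _ ltji; rewrite eq_sym in inj.
    by move=> b b' e; apply: (inj ij); congr pair;
      [exact: (congr1 snd e) | exact: (congr1 fst e)].
  - by rewrite eqij eqxx in ij.
move=> [a b] [a' b'] e; have e1 := congr1 fst e; have e2 := congr1 snd e.
move: e1 e2 => {e} /= e1 e2.
have unit_ji : ((j - i)%:R : 'Z_r) \is a GRing.unit.
  rewrite unitZpE//; apply: coprime_dvdr rK.
  by apply: dvdn_fact; rewrite subn_gt0 ij /= (leq_trans (leq_subr _ _))// ltnW.
have aa' : a = a'.
  apply: (mulIr unit_ji); rewrite natrB; last exact: ltnW.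
  have -> : a * (j%:R - i%:R) = (a * j%:R + b) - (a * i%:R + b) by ring.
  by rewrite e1 e2; ring.
by move: e1; rewrite aa' => /addrI ->.
Qed.

(** [N] is the number of coordinates contributed by one sign block. Taking [m] blocks with [m] the
    quotient of [d + r^2] by [N], and padding by the remainder, gives [m N >= d - N]. *)
Lemma theta_le_affine_net (R : realType) (F : base_field) (K r d k : nat) :
  let N := (K * r * 2 ^ (r * r))%N in
  (1 < K)%N -> (1 < r)%N -> coprime r K`! -> (k <= r * r)%N -> (N < d)%N ->
  theta R F d k <= K%:R * r%:R / (K.-1%:R * (d - N)%:R).
Proof.
move=> N K1 r1 rK kr Nd; pose m := ((d + r * r) %/ N)%N.
have N0 : (0 < N)%N by rewrite !muln_gt0 expn_gt0 /= andbT; lia.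
have cardZ : #|'Z_r| = r by rewrite card_ord Zp_cast.
have cardZZ : #|{: 'Z_r * 'Z_r}| = (r * r)%N by rewrite card_prod cardZ.
have m0 : (0 < m)%N by rewrite divn_gt0//; lia.
apply: (@le_trans _ _ ((m * 2 ^ (r * r) * K.-1)%:R)^-1).
  rewrite -cardZZ.
  apply: (theta_le_net_pad _ _ _ ((d + r * r) %% N) _ 'Z_r
    (fun i b => b.1 * i%:R + b.2)) => //.
  - by move=> i j; apply: Zp_net.
  - by rewrite cardZZ.
  - by rewrite cardZZ cardZ [LHS](divn_eq _ N) -/m /N; congr addn; ring.
have mN : ((d - N)%:R : R) <= (m * N)%:R.
  have := ltn_pmod (d + r * r) N0; have := divn_eq (d + r * r) N.
  by rewrite ler_nat -/m; lia.
have pos n : (0 < n)%N -> 0 < n%:R :> R by rewrite ltr0n.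
have K10 : (0 < K.-1)%N by case: (K) K1 => [|[]].
have -> : (m * 2 ^ (r * r) * K.-1)%:R^-1 = K%:R * r%:R / (K.-1%:R * (m * N)%:R) :> R.
  rewrite /N !natrM; field.
  by rewrite !gt_eqF// pos ?expn_gt0//; lia.
apply: ler_wpM2l; first by rewrite mulr_ge0.
rewrite lef_pV2 ?posrE ?mulr_gt0 ?pos ?(muln_gt0 m) ?m0 ?N0 ?subn_gt0//.
by rewrite ler_wpM2l.
Qed.

(** * Choice of the parameters and passage to the limit *)

Theorem theorem1p6 (R : realType) (F : base_field) (eps : R) :
  0 < eps ->
  exists k0 : nat, forall k : nat, (0 < k)%N -> (k0 <= k)%N ->
  exists o : nat -> R,
    (o d @[d --> \oo] --> (0 : R)) /\
    forall d : nat, (0 < d)%N ->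
      theta R F d k <= (1 + o d) * ((1 + eps) * Num.sqrt k%:R / d%:R).
Proof.
move=> eps0.
(* [K - 1 > 2 / eps] gives [K / (K - 1) <= 1 + eps / 2]. The constant [c] solves
   [(1 + eps / 2) (c + M + 1) = (1 + eps) c], so the rounding of [y] up to [r] is absorbed once
   [y >= c]. *)
pose K := (Num.trunc (2 / eps)).+2; pose M := K`!.
pose c : R := (1 + eps / 2) * (M%:R + 1) * 2 / eps.
have c0 : 0 <= c.
  apply: divr_ge0; last exact: ltW.
  by rewrite !mulr_ge0 ?addr_ge0// divr_ge0// ltW.
exists (Num.trunc (c ^+ 2)).+1 => k k_gt0 kk0.
have ck : c <= Num.sqrt k%:R.
  rewrite -(ger0_norm c0) -sqrtr_sqr ler_wsqrtr// ltW//.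
  by rewrite (lt_le_trans (truncnS_gt _))// ler_nat.
set y := Num.sqrt k%:R in ck *.
have y0 : 0 < y by rewrite sqrtr_gt0 ltr0n.
have M0 : (0 < M)%N by exact: fact_gt0.
have M0R : 0 < M%:R :> R by rewrite ltr0n.
(* [r] is congruent to 1 modulo [K!], hence coprime to it, and lies between [y] and [y + M + 1]. *)
pose q := (Num.trunc (y / M%:R)).+1; pose r := (M * q).+1.
have /andP[qy yq] := truncn_itv (ltW (divr_gt0 y0 M0R)).
have yr : y <= r%:R.
  rewrite /r -natr1 natrM; apply: ltW; rewrite ltr_wpDr//.
  by rewrite mulrC -ltr_pdivrMr.
have ry : r%:R <= y + (M%:R + 1).
  rewrite /r /q -natr1 natrM -natr1 mulrDr mulr1 addrA !lerD2r.
  by rewrite mulrC -ler_pdivlMr.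
have kr : (k <= r * r)%N.
  rewrite -(ler_nat R) natrM -expr2 -[k%:R](@sqr_sqrtr R) ?ler0n//.
  by rewrite ler_pXn2r ?nnegrE// ltW.
have r1 : (1 < r)%N by rewrite ltnS muln_gt0 M0.
have rK : coprime r K`! by rewrite coprime_sym /r -addn1 mulnC /coprime gcdnMDl gcdn1.
pose N := (K * r * 2 ^ (r * r))%N.
pose A := (1 + eps) * y.
have A0 : 0 < A by rewrite mulr_gt0// addr_gt0.
have KrA : K%:R * r%:R / K.-1%:R <= A.
  have T0 : 2 / eps < K.-1%:R by exact: truncnS_gt.
  have K0 : 0 < K.-1%:R :> R by rewrite ltr0n.
  have -> : K%:R * r%:R / K.-1%:R = r%:R * (1 + K.-1%:R^-1) :> R.
    by rewrite -[in LHS](natr1 K.-1); field; rewrite gt_eqF.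
  have Ki : K.-1%:R^-1 <= eps / 2.
    rewrite -[eps / 2]invrK lef_pV2 ?posrE ?invr_gt0 ?divr_gt0//.
    by rewrite invf_div ltW.
  have cE : (1 + eps / 2) * (M%:R + 1) = c * (eps / 2).
    by rewrite /c; field; rewrite gt_eqF.
  apply: (@le_trans _ _ ((y + (M%:R + 1)) * (1 + eps / 2))).
    by apply: ler_pM => //; rewrite ?lerD2l// addr_ge0// invr_ge0.
  rewrite mulrDl [X in _ + X]mulrC cE /A.
  have : c * (eps / 2) <= y * (eps / 2) by rewrite ler_wpM2r// divr_ge0// ltW.
  lra.
have theta_le d : (N < d)%N -> theta R F d k <= A / (d - N)%:R.
  move=> Nd; apply: le_trans (theta_le_affine_net _ _ K _ _ _ _ r1 rK kr Nd) _ => //.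
  by rewrite invfM mulrA ler_wpM2r.
(* The relative excess of [theta] over [A / d], cut off at 0 so that only an upper bound remains to
   be shown. It is at most [N / (d - N)], which is below [2 N / (d + 1)] once [d > 2 N]. *)
exists (fun d => Num.max 0 (theta R F d k * d%:R / A - 1)); split.
  apply: (@squeeze_cvgr _ _ _ _ (fun=> 0) (fun d => (2 * N)%:R * harmonic d)).
  - near=> d; rewrite le_max lexx /= ge_max mulr_ge0 ?invr_ge0//=.
    have Nd : (2 * N < d)%N by near: d; exact: nbhs_infty_gt.
    have dN : 0 < (d - N)%:R :> R by rewrite ltr0n; lia.
    rewrite lerBlDr ler_pdivrMr//.
    apply: (@le_trans _ _ (A / (d - N)%:R * d%:R)).
      by rewrite ler_wpM2r// theta_le//; lia.
    rewrite -mulrA mulrC ler_pM2r// ler_pdivrMl// mulrDr mulr1.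
    have -> : d%:R = N%:R + (d - N)%:R :> R by rewrite -natrD subnKC//; lia.
    rewrite lerD2r mulrA ler_pdivlMr ?ltr0n// -!natrM ler_nat.
    nia.
  - exact: cvg_cst.
  - rewrite -(mulr0 (2 * N)%:R); apply: cvgM; first exact: cvg_cst.
    exact: cvg_harmonic.
move=> d d0; rewrite mulrA ler_pdivlMr ?ltr0n// -ler_pdivrMr//.
by rewrite -lerBlDl le_max lexx orbT.
Unshelve. all: by end_near.
Qed.
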